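(* Let $\mathcal{E}$ be a countable directed graph without sinks and let $G$ be its path groupoid. The r-discrete groupoid $G$ is essentially principal if and only if $\mathcal{E}$ satisfies condition (K).
   Context: Graph conventions. $\mathcal{E}$ is a directed graph with countable vertex set $V$ and countable edge set $E$; $s(e),r(e)$ are the initial and terminal vertices of an edge $e$. No sinks: every vertex is the source of at least one edge. $V_\infty$ is the set of vertices emitting infinitely many edges. A finite path is $\alpha=e_1\cdots e_k$ with $r(e_i)=s(e_{i+1})$, length $l(\alpha)=k$, $s(\alpha)=s(e_1)$, $r(\alpha)=r(e_k)$; each vertex $v$ is a finite path of length $0$ with $s(v)=r(v)=v$, and $s(\mu)\mu=\mu=\mu r(\mu)$. $Y$ is the set of finite paths, $Z$ the set of infinite paths $z_1z_2\cdots$, and $Y_\infty=\{y\in Y: r(y)\in V_\infty\}$. Condition (K). A loop based at $v\in V$ is a finite path $\alpha=e_1\cdots e_n$ ($n\ge1$) with $r(\alpha)=s(\alpha)=v$ and $r(e_i)\neq v$ for $1\le i<n$. $\mathcal{E}$ satisfies condition (K) if there is no vertex $v$ with exactly one loop based at $v$. Path groupoid. $X=Y_\infty\cup Z$. $G$ is the set of triples $(\alpha\gamma,\,l(\alpha)-l(\beta),\,\beta\gamma)$ with $\alpha,\beta\in Y$, $\gamma\in X$, $r(\alpha)=r(\beta)=s(\gamma)$; multiplication $(x,m,y)(y,n,w)=(x,m+n,w)$, inverse $(x,m,y)^{-1}=(y,-m,x)$, unit space $G^0$ identified with $X$ via $x\leftrightarrow(x,0,x)$. For $\alpha,\beta\in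 Y$ with $r(\alpha)=r(\beta)$ let $A'_{\alpha,\beta}=\{(\alpha\gamma,l(\alpha)-l(\beta),\beta\gamma)\in G\}$. A basis for the topology of $G$ is given by the sets $A'_{\alpha,\beta}\setminus\bigcup_{i=1}^nA'_{\alpha\mu_i,\beta\mu_i}$ ($n\ge 0$, $\mu_i\in Y$ with $s(\mu_i)=r(\alpha)$). $G$ is an r-discrete (étale) locally compact Hausdorff groupoid. A locally compact groupoid $G$ is essentially principal if for every closed invariant subset $F$ of $G^0$, the set of $u\in F$ with trivial isotropy group $\{g\in G: r(g)=s(g)=u\}$ is dense in $F$. ($F$ is invariant if $r(g)\in F$ if and only if $s(g)\in F$, for all $g\in G$.) *)

(* Defs.v *)
From HB Require Import structures.
From mathcomp Require Import all_boot all_order all_algebra.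
From mathcomp Require Import all_classical topology zify.

Set Implicit Arguments.
Unset Strict Implicit.
Unset Printing Implicit Defensive.

Import Order.TTheory GRing.Theory Num.Theory.

Local Open Scope classical_set_scope.

(** Groupoids with space of units [U] and set of arrows [A]. The product
    [gmul g h e] is only defined on composable pairs, [e] being a proof that
    the source of [g] is the range of [h]. *)
Record groupoid (U A : Type) := Groupoid {
  grng : A -> U;
  gsrc : A -> U;
  gunit : U -> A;
  gmul : forall g h : A, gsrc g = grng h -> A;
  ginv : A -> A;
  grng_unit : forall u, grng (gunit u) = u;
  gsrc_unit : forall u, gsrc (gunit u) = u;
  grng_mul : forall g h (gh : gsrc g = grng h), grng (gmul gh) = grng g;
  gsrc_mul : forall g h (gh : gsrc g = grng h), gsrc (gmul gh) = gsrc h;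
  grng_inv : forall g, grng (ginv g) = gsrc g;
  gsrc_inv : forall g, gsrc (ginv g) = grng g;
  gmulA : forall g h k (gh : gsrc g = grng h) (hk : gsrc h = grng k)
    (g_hk : gsrc g = grng (gmul hk)) (gh_k : gsrc (gmul gh) = grng k),
    gmul g_hk = gmul gh_k;
  gmul1 : forall g u (gu : gsrc g = grng (gunit u)), gmul gu = g;
  g1mul : forall g u (ug : gsrc (gunit u) = grng g), gmul ug = g;
  gmulV : forall g (gV : gsrc g = grng (ginv g)), gmul gV = gunit (grng g);
  gVmul : forall g (Vg : gsrc (ginv g) = grng g), gmul Vg = gunit (gsrc g)
}.

Section EssentiallyPrincipal.
Variables (U : choiceType) (A : topologicalType) (G : groupoid U A).

(** [G^0], with the topology that it inherits from the arrow space through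
    the identification of a unit [u] with the arrow [gunit G u]. *)
Definition unit_space := initial_topology (gunit G).

Definition invariant_set (F : set U) : Prop :=
  forall g : A, F (grng G g) <-> F (gsrc G g).

Definition isotropy (u : U) : set A :=
  [set g | grng G g = u /\ gsrc G g = u].

Definition trivial_isotropy (u : U) : Prop := isotropy u = [set gunit G u].

(** [F] is closed, so density of a subset in [F] is that its closure in [G^0]
    contains [F]. *)
Definition essentially_principal : Prop :=
  forall F : set unit_space, closed F -> invariant_set F ->
    F `<=` closure (F `&` trivial_isotropy).

End EssentiallyPrincipal.

Record digraph := Digraph {
  vertex : countType;
  edge : countType;
  esrc : edge -> vertex;
  erng : edge -> vertex
}.

Section Graph.
Variable E : digraph.
Local Notation V := (vertex E).
Local Notation src := (@esrc E).
Local Notation rng := (@erng E).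

Definition no_sinks : Prop := forall v : V, exists e : edge E, src e = v.

Definition infinite_emitter (v : V) : Prop := infinite_set [set e | src e = v].

Fixpoint walk (v : V) (p : seq (edge E)) : bool :=
  if p is e :: p' then (src e == v) && walk (rng e) p' else true.

(** The initial vertex is recorded separately from the edges, so that the
    paths of length 0 are the vertices. *)
Record finpath := Finpath {
  finpath_val :> V * seq (edge E);
  finpathP : walk finpath_val.1 finpath_val.2
}.

HB.instance Definition _ := [isSub for finpath_val].
HB.instance Definition _ := [Countable of finpath by <:].

Definition psrc (p : finpath) : V := (finpath_val p).1.
Definition pedges (p : finpath) : seq (edge E) := (finpath_val p).2.
Definition prng (p : finpath) : V := last (psrc p) (map rng (pedges p)).
Definition plen (p : finpath) : nat := size (pedges p).

Record infpath := Infpath {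
  iedge :> nat -> edge E;
  infpathP : forall n, rng (iedge n) = src (iedge n.+1)
}.

(** [v] is not revisited before the end: the last edge is the only one with
    range [v]. *)
Definition loop_at (v : V) (p : finpath) : Prop :=
  [/\ (1 <= plen p)%N, psrc p = v, prng p = v
    & forall e, e \in take (plen p).-1 (pedges p) -> rng e <> v].

Definition condition_K : Prop :=
  forall v : V, ~ exists! p : finpath, loop_at v p.

(** The unit space: the finite paths ending at an infinite emitter, together with the
    infinite paths. *)
Inductive bpath : Type :=
| BFin (y : finpath) of infinite_emitter (prng y)
| BInf (z : infpath).

HB.instance Definition _ := gen_eqMixin bpath.
HB.instance Definition _ := gen_choiceMixin bpath.

Definition bsrc (x : bpath) : V :=
  match x with BFin y _ => psrc y | BInf z => src (z 0%N) end.

Lemma walk_cat v p q :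
  walk v (p ++ q) = walk v p && walk (last v (map rng p)) q.
Proof. by elim: p v => [|e p IHp] v //=; rewrite IHp andbA. Qed.

Lemma pcatP (a m : finpath) : prng a = psrc m ->
  walk (psrc a, pedges a ++ pedges m).1 (psrc a, pedges a ++ pedges m).2.
Proof. by move=> am; rewrite /= walk_cat (finpathP a) [last _ _]am (finpathP m). Qed.

Definition pcat (a m : finpath) (am : prng a = psrc m) : finpath :=
  Finpath (pcatP am).

Lemma prng_pcat a m (am : prng a = psrc m) : prng (pcat am) = prng m.
Proof. by rewrite /prng /= map_cat last_cat [last (psrc a) _]am. Qed.

Lemma plen_pcat a m (am : prng a = psrc m) :
  plen (pcat am) = (plen a + plen m)%N.
Proof. by rewrite /plen /= size_cat. Qed.

Definition icat_edge (a : finpath) (z : infpath) (n : nat) : edge E :=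
  nth (z (n - plen a)%N) (pedges a) n.

Lemma walk_nth x0 v p n : walk v p -> (n.+1 < size p)%N ->
  rng (nth x0 p n) = src (nth x0 p n.+1).
Proof.
elim: p v n => [|e p IHp] v [|n] //= /andP[_]; last exact: IHp.
by case: p {IHp} => [|f p] //= /andP[/eqP->].
Qed.

Lemma icatP a (z : infpath) : prng a = src (z 0%N) ->
  forall n, rng (icat_edge a z n) = src (icat_edge a z n.+1).
Proof.
move=> az n; rewrite /icat_edge /plen.
case: (ltngtP n.+1 (size (pedges a))) => na.
- rewrite (set_nth_default (z (n.+1 - size (pedges a))%N)) ?(ltn_trans _ na)//.
  by apply: walk_nth na; apply: finpathP.
- by rewrite !nth_default ?(ltnW na)// subSn// infpathP.
- rewrite [in RHS]nth_default ?na// subnn -az /prng.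
  by rewrite (last_nth (psrc a)) size_map -na /= (nth_map (z (n - n.+1)%N)) ?na.
Qed.

Definition icat (a : finpath) (z : infpath) (az : prng a = src (z 0%N)) :
  infpath := Infpath (icatP az).

Definition bcat (a : finpath) (x : bpath) : prng a = bsrc x -> bpath :=
  match x return prng a = bsrc x -> bpath with
  | BFin y yoo => fun ay =>
      BFin (eq_ind_r infinite_emitter yoo (prng_pcat ay))
  | BInf z => fun az => BInf (icat az)
  end.

(** The triple [(x, d, y)] has the form [(a c, l(a) - l(b), b c)]. *)
Definition is_lag (a b : finpath) (x : bpath) (d : int) (y : bpath) : Prop :=
  exists c (ac : prng a = bsrc c) (bc : prng b = bsrc c),
    [/\ x = bcat ac, d = ((plen a)%:Z - (plen b)%:Z)%R & y = bcat bc].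

Record parrow := Parrow {
  arng : bpath;
  adeg : int;
  asrc : bpath;
  parrowP : exists a b, is_lag a b arng adeg asrc
}.

HB.instance Definition _ := gen_eqMixin parrow.
HB.instance Definition _ := gen_choiceMixin parrow.

Definition cylinder (a b : finpath) : set parrow :=
  [set g | is_lag a b (arng g) (adeg g) (asrc g)].

Definition basic_open (a b : finpath) (ms : seq finpath) : set parrow :=
  cylinder a b `\`
    [set g | exists2 m, m \in ms & exists (am : prng a = psrc m)
      (bm : prng b = psrc m), cylinder (pcat am) (pcat bm) g].

Definition basic_family : set (set parrow) :=
  [set W | exists a b ms, [/\ prng a = prng b,
    forall m, m \in ms -> psrc m = prng a & W = basic_open a b ms]].

Definition bedge (x : bpath) (n : nat) : option (edge E) :=
  match x with BFin y _ => onth (pedges y) n | BInf z => Some (z n) end.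

Lemma finpath_eq (p q : finpath) :
  psrc p = psrc q -> pedges p = pedges q -> p = q.
Proof.
case: p q => [[v p] P] [[w q] Q]; rewrite /psrc /pedges /= => vw pq.
by apply: val_inj => /=; rewrite vw pq.
Qed.

Lemma infpath_eq (z w : infpath) : (forall n, z n = w n) -> z = w.
Proof.
case: z w => [z P] [w Q] /= /funext zw; subst w.
by rewrite (Prop_irrelevance P Q).
Qed.

Lemma onth_inj (T : Type) (s t : seq T) : (forall n, onth s n = onth t n) -> s = t.
Proof.
elim: s t => [|x s IHs] [|y t] // st.
- by have := st 0%N.
- by have := st 0%N.
- by have [->] := st 0%N; rewrite (IHs t)// => n; have := st n.+1.
Qed.

Lemma onth_oversize (T : Type) (s : seq T) n : (size s <= n)%N -> onth s n = None.
Proof. by elim: s n => [|x s IHs] [|n] //= /IHs. Qed.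

Lemma onth_cat (T : Type) (s t : seq T) n :
  onth (s ++ t) n = if (n < size s)%N then onth s n else onth t (n - size s).
Proof. by elim: s n => [|x s IHs] [|n] //=; apply: IHs. Qed.

Lemma onth_nth_lt (T : Type) x0 (s : seq T) n :
  (n < size s)%N -> onth s n = Some (nth x0 s n).
Proof. by elim: s n => [|x s IHs] [|n] //=; apply: IHs. Qed.

Lemma bpath_eq (x y : bpath) :
  bsrc x = bsrc y -> (forall n, bedge x n = bedge y n) -> x = y.
Proof.
case: x y => [p P|z] [q Q|w] /= s n.
- have pq : p = q by apply: finpath_eq => //; apply: onth_inj.
  by subst q; rewrite (Prop_irrelevance P Q).
- by have := n (size (pedges p)); rewrite onth_oversize.
- by have := n (size (pedges q)); rewrite onth_oversize.
- by congr BInf; apply: infpath_eq => k; have [] := n k.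
Qed.

Lemma bsrc_bcat a x (ax : prng a = bsrc x) : bsrc (bcat ax) = psrc a.
Proof.
case: x ax => //= z az; rewrite /icat_edge /plen /=.
have := finpathP a; rewrite -/(pedges a) -/(psrc a).
move: az; rewrite /prng; case: (pedges a) => //= e p _ /andP[/eqP].
by [].
Qed.

Lemma bedge_bcat a x (ax : prng a = bsrc x) n : bedge (bcat ax) n =
  if (n < plen a)%N then onth (pedges a) n else bedge x (n - plen a).
Proof.
case: x ax => [y Y|z] /= ax; first by rewrite onth_cat.
rewrite /icat_edge; case: ltnP => na; last by rewrite nth_default.
by rewrite (onth_nth_lt (z (n - plen a)%N)).
Qed.

Lemma bcat_pcat a m x (am : prng a = psrc m) (mx : prng m = bsrc x)
  (amx : prng (pcat am) = bsrc x) (a_mx : prng a = bsrc (bcat mx)) :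
  bcat amx = bcat a_mx.
Proof.
apply: bpath_eq => [|n]; first by rewrite !bsrc_bcat.
rewrite !bedge_bcat plen_pcat /= onth_cat -/(plen a).
case: (ltnP n (plen a)) => na; first by rewrite ltn_addr.
by rewrite ltn_subLR// subnDA.
Qed.

Lemma bcat_factor a b x y (ax : prng a = bsrc x) (b_y : prng b = bsrc y) :
  bcat ax = bcat b_y -> (plen b <= plen a)%N ->
  exists m (bm : prng b = psrc m) (mx : prng m = bsrc x),
    a = pcat bm /\ y = bcat mx.
Proof.
move=> xy ba.
have sab : psrc a = psrc b by rewrite -(bsrc_bcat ax) xy bsrc_bcat.
have edE n : bedge (bcat ax) n = bedge (bcat b_y) n by rewrite xy.
have eab : pedges a = pedges b ++ drop (plen b) (pedges a).
  rewrite -{1}(cat_take_drop (plen b) (pedges a)); congr (_ ++ _).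
  have stake : size (take (plen b) (pedges a)) = plen b by rewrite size_takel.
  apply: onth_inj => n; case: (ltnP n (plen b)) => nb; last first.
    by rewrite !onth_oversize ?stake.
  have := edE n; rewrite !bedge_bcat nb (leq_trans nb ba) => <-.
  by rewrite -{2}(cat_take_drop (plen b) (pedges a)) onth_cat stake nb.
have wa : walk (psrc b) (pedges b ++ drop (plen b) (pedges a)).
  by rewrite -eab -sab (finpathP a).
have wm : walk (prng b) (drop (plen b) (pedges a)).
  by move: wa; rewrite walk_cat => /andP[].
pose m := @Finpath (prng b, drop (plen b) (pedges a)) wm.
have bm : prng b = psrc m by [].
have aE : a = pcat bm by apply: finpath_eq.
have mx : prng m = bsrc x by rewrite -ax aE prng_pcat.
exists m, bm, mx; split=> //.
apply: bpath_eq => [|n]; first by rewrite bsrc_bcat -b_y.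
have := edE (plen b + n)%N; rewrite !bedge_bcat [(_ < plen b)%N]ltnNge leq_addr/= addKn.
rewrite [X in onth X]eab onth_cat -/(plen b).
rewrite [(_ + n < plen b)%N]ltnNge leq_addr/= addKn.
have -> : plen a = (plen b + plen m)%N by rewrite aE plen_pcat.
by rewrite ltn_add2l subnDl => <-.
Qed.

Lemma parrow_eq (g h : parrow) : arng g = arng h -> adeg g = adeg h ->
  asrc g = asrc h -> g = h.
Proof.
case: g h => [x d y P] [x' d' y' Q] /= xx dd yy; subst x' d' y'.
by rewrite (Prop_irrelevance P Q).
Qed.

Lemma punit_subproof x : exists a b, is_lag a b x 0%R x.
Proof.
pose v := @Finpath (bsrc x, [::]) isT.
have vx : prng v = bsrc x by [].
exists v, v, x, vx, vx; rewrite subrr.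
by split=> //; apply: bpath_eq => [|n]; rewrite ?bsrc_bcat// bedge_bcat/= subn0.
Qed.

Definition punit (x : bpath) : parrow := Parrow (punit_subproof x).

Lemma is_lag_sym a b x d y : is_lag a b x d y -> is_lag b a y (- d)%R x.
Proof. by move=> [c [ac [bc [-> -> ->]]]]; exists c, bc, ac; rewrite opprB. Qed.

Lemma pinv_subproof g : exists a b, is_lag a b (asrc g) (- adeg g)%R (arng g).
Proof. by have [a [b /is_lag_sym]] := parrowP g; exists b, a. Qed.

Definition pinv (g : parrow) : parrow := Parrow (pinv_subproof g).

Lemma is_lag_comp a b c d x m y n w : (plen c <= plen b)%N ->
  is_lag a b x m y -> is_lag c d y n w ->
  exists e, is_lag a e x (m + n)%R w.
Proof.
move=> cb [t [at_ [bt [-> -> ->]]]] [u [cu [du [eq -> ->]]]].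
have [k [ck [kt [bE uE]]]] := bcat_factor eq cb; subst u.
have dk : prng d = psrc k by rewrite du bsrc_bcat.
have dkt : prng (pcat dk) = bsrc t by rewrite prng_pcat.
exists (pcat dk), t, at_, dkt; split=> //.
  rewrite bE !plen_pcat.
  by lia.
by apply/esym/bcat_pcat.
Qed.

Lemma pmul_subproof g h : asrc g = arng h ->
  exists a b, is_lag a b (arng g) (adeg g + adeg h)%R (asrc h).
Proof.
move=> gh; have [a [b gP]] := parrowP g; have [c [d hP]] := parrowP h.
rewrite -gh in hP; case: (leqP (plen c) (plen b)) => [cb|/ltnW bc].
  by exists a; have [e ?] := is_lag_comp cb gP hP; exists e.
have [e eP] := is_lag_comp bc (is_lag_sym hP) (is_lag_sym gP).
exists e, d; have := is_lag_sym eP.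
by rewrite opprD !opprK addrC.
Qed.

Definition pmul (g h : parrow) (gh : asrc g = arng h) : parrow :=
  Parrow (pmul_subproof gh).

Lemma pmulA g h k (gh : asrc g = arng h) (hk : asrc h = arng k)
  (g_hk : asrc g = arng (pmul hk)) (gh_k : asrc (pmul gh) = arng k) :
  pmul g_hk = pmul gh_k.
Proof. by apply: parrow_eq => //=; rewrite addrA. Qed.

Lemma pmul1 g x (gx : asrc g = arng (punit x)) : pmul gx = g.
Proof. by apply: parrow_eq => //=; rewrite addr0. Qed.

Lemma p1mul g x (xg : asrc (punit x) = arng g) : pmul xg = g.
Proof. by apply: parrow_eq => //=; rewrite add0r. Qed.

Lemma pmulV g (gV : asrc g = arng (pinv g)) : pmul gV = punit (arng g).
Proof. by apply: parrow_eq => //=; rewrite subrr. Qed.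

Lemma pVmul g (Vg : asrc (pinv g) = arng g) : pmul Vg = punit (asrc g).
Proof. by apply: parrow_eq => //=; rewrite addNr. Qed.

Definition path_groupoid : groupoid bpath parrow :=
  @Groupoid bpath parrow arng asrc punit pmul pinv
    (fun=> erefl) (fun=> erefl) (fun _ _ _ => erefl) (fun _ _ _ => erefl)
    (fun=> erefl) (fun=> erefl) pmulA pmul1 p1mul pmulV pVmul.

Lemma cylinder_pcat a b m (am : prng a = psrc m) (bm : prng b = psrc m) :
  cylinder (pcat am) (pcat bm) `<=` cylinder a b.
Proof.
move=> g; rewrite /cylinder /= => -[c [amc [bmc [-> -> ->]]]].
have mc : prng m = bsrc c by rewrite -amc prng_pcat.
have ac : prng a = bsrc (bcat mc) by rewrite bsrc_bcat.
have bc : prng b = bsrc (bcat mc) by rewrite bsrc_bcat.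
exists (bcat mc), ac, bc; split; try exact: bcat_pcat.
by rewrite !plen_pcat; lia.
Qed.

Lemma cylinder_factor a b c d g : (plen c <= plen a)%N ->
  cylinder a b g -> cylinder c d g ->
  exists m (cm : prng c = psrc m) (dm : prng d = psrc m),
    a = pcat cm /\ b = pcat dm.
Proof.
move=> ca [x [ax [bx [gr gd gs]]]] [y [cy [dy [gr' gd' gs']]]].
have [m [cm [mx [aE yE]]]] := bcat_factor (etrans (esym gr) gr') ca.
have aS : plen a = (plen c + plen m)%N by rewrite aE plen_pcat.
have bS : plen b = (plen d + plen m)%N by move: gd; rewrite gd' aS; lia.
have db : (plen d <= plen b)%N by rewrite bS leq_addr.
have [m' [dm' [mx' [bE yE']]]] := bcat_factor (etrans (esym gs) gs') db.
have mm : m = m'.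
  apply: finpath_eq; first by rewrite -dm' dy yE bsrc_bcat.
  have mS : plen m = plen m'.
    by apply/eqP; rewrite -(eqn_add2l (plen d)) -bS bE plen_pcat.
  apply: onth_inj => n; case: (ltnP n (plen m)) => nm; last first.
    by rewrite !onth_oversize// -/(plen m') -mS.
  have := congr1 (fun y => bedge y n) (etrans (esym yE) yE').
  by rewrite !bedge_bcat -mS nm.
by subst m'; exists m, cm, dm'.
Qed.

Lemma basic_cover : \bigcup_(W in basic_family) W = setT.
Proof.
apply/seteqP; split=> // g _; have [a [b gP]] := parrowP g.
exists (basic_open a b [::]).
  exists a, b, [::]; split=> //.
  by have [c [ac [bc _]]] := gP; rewrite ac bc.
by split=> // -[].
Qed.

(** Cutting down the excluded extensions of [(c, d)] to those of the longer
    pair [(a, b)]. *)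
Lemma basic_shrink a b c d ms g : (plen c <= plen a)%N ->
  cylinder a b g -> basic_open c d ms g ->
  exists ns, [/\ forall n, n \in ns -> psrc n = prng a, basic_open a b ns g &
    basic_open a b ns `<=` basic_open c d ms].
Proof.
move=> ca gab [gcd gms].
have [k [ck [dk [aE bE]]]] := cylinder_factor ca gab gcd.
(* [n] is retained when [k n = m] for an excluded [m] *)
pose tailp m := if psrc m == psrc k then
    (if take (plen k) (pedges m) == pedges k then
      insub (prng a, drop (plen k) (pedges m)) else None)
  else None : option finpath.
pose ns := pmap tailp ms.
have tailE m n : tailp m = Some n ->
    [/\ psrc m = psrc k, pedges m = pedges k ++ pedges n & psrc n = prng a].
  rewrite /tailp; case: eqP => // mk; case: eqP => // mk'.
  case: insubP => // n' _ nE [<-]; split=> //; last by rewrite /psrc nE.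
  have -> : pedges n' = drop (plen k) (pedges m) by rewrite /pedges nE.
  by rewrite -mk' cat_take_drop.
have tailI m n (kn : prng k = psrc n) : m = pcat kn -> tailp m = Some n.
  move=> ->; rewrite /tailp eqxx /= take_size_cat// eqxx drop_size_cat//.
  have -> : (prng a, pedges n) = finpath_val n.
    by rewrite aE prng_pcat kn [RHS]surjective_pairing.
  by rewrite valK.
have nsP n : n \in ns -> exists2 m, m \in ms & tailp m = Some n.
  by rewrite mem_pmap => /mapP[m mms mn]; exists m.
exists ns; split.
- by move=> n /nsP[m _ /tailE[]].
- split=> // -[n /nsP[m mms /tailE[mk mE na]] [an [bn gn]]].
  apply: gms; exists m => //.
  have cm : prng c = psrc m by rewrite mk.
  have dm : prng d = psrc m by rewrite mk.
  exists cm, dm.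
  have <- : pcat an = pcat cm.
    by apply: finpath_eq; rewrite /psrc /pedges /= aE//= mE catA.
  have <- : pcat bn = pcat dm.
    by apply: finpath_eq; rewrite /psrc /pedges /= bE//= mE catA.
  exact: gn.
- move=> h [hab hns]; split; first by move: hab; rewrite aE bE; apply: cylinder_pcat.
  move=> [m mms [cm [dm hm]]].
  have plcm : plen (pcat cm) = (plen c + plen m)%N by rewrite plen_pcat.
  case: (leqP (plen (pcat cm)) (plen a)) => [cma|/ltnW acm].
    apply: gms; exists m => //; exists cm, dm.
    have [j [j1 [j2 [aj bj]]]] := cylinder_factor cma hab hm.
    by move: gab; rewrite aj bj; apply: cylinder_pcat.
  have [n [an [bn [cmE dmE]]]] := cylinder_factor acm hm hab.
  have kn : prng k = psrc n by rewrite -an aE prng_pcat.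
  have mE : m = pcat kn.
    apply: finpath_eq; first by rewrite -cm ck.
    have /(congr1 pedges) := cmE.
    rewrite /pedges /= {1}aE /= -catA => /eqP.
    by rewrite eqseq_cat// eqxx => /eqP.
  apply: hns; exists n; last by exists an, bn; rewrite -cmE -dmE.
  by rewrite mem_pmap; apply/mapP; exists m => //; rewrite (tailI m n kn mE).
Qed.

Lemma basic_openU a b ms ns : basic_open a b (ms ++ ns) =
  basic_open a b ms `&` basic_open a b ns.
Proof.
apply/seteqP; split=> g.
  move=> [gab gN]; split; split=> // -[m mm mP]; apply: gN; exists m => //;
  by rewrite mem_cat mm ?orbT.
move=> [[gab gms] [_ gns]]; split=> // -[m].
by rewrite mem_cat => /orP[] mm mP; [apply: gms|apply: gns]; exists m.
Qed.

Lemma basic_join (W W' : set parrow) g : basic_family W -> basic_family W' ->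
  W g -> W' g ->
  exists W'', [/\ basic_family W'', W'' g & W'' `<=` W `&` W'].
Proof.
have main a b ms c d ns : prng a = prng b ->
    (forall m, m \in ms -> psrc m = prng a) -> (plen c <= plen a)%N ->
    basic_open a b ms g -> basic_open c d ns g ->
    exists W'', [/\ basic_family W'', W'' g &
      W'' `<=` basic_open a b ms `&` basic_open c d ns].
  move=> ab abms ca Wg Wg'.
  have [ks [ksa gks sub]] := basic_shrink ca (proj1 Wg) Wg'.
  exists (basic_open a b (ms ++ ks)); rewrite basic_openU; split=> //.
    exists a, b, (ms ++ ks); rewrite basic_openU; split=> // m.
    by rewrite mem_cat => /orP[/abms|/ksa].
  by move=> h [h1 /sub].
move=> [a [b [ms [ab abms ->]]]] [c [d [ns [cd cdns ->]]]] Wg Wg'.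
case: (leqP (plen c) (plen a)) => [ca|/ltnW ac]; first exact: main.
by rewrite setIC; apply: main.
Qed.

HB.instance Definition _ := @isBaseTopological.Build parrow
  (set parrow : pointedType) basic_family id basic_cover basic_join.

End Graph.

(* Main.v *)
(** Only eventually periodic infinite paths have nontrivial isotropy.

    If condition (K) holds and [z] is such a path in a closed invariant set [F],
    a vertex [v] on its period has two distinct loops. Continuing a long initial
    segment of [z] by these two loops gives infinite paths near [z]; they lie in
    [F], as limits of paths that end like [z]. The eventually periodic paths being
    countably many, a diagonal choice of the loops yields an aperiodic one.

    If [v] has a unique loop [l], the limits in [X] of the infinite paths from all
    of whose vertices [v] can be reached form a closed invariant set. Any closed
    walk at [v] is a power of [l], so that the only point of this set starting at
    [v] is the infinite power of [l], which is thus isolated in it although its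
    isotropy is not trivial. *)

Require Import Defs.
From mathcomp Require Import all_boot.
From mathcomp Require Import all_algebra all_classical topology zify.

Set Implicit Arguments.
Unset Strict Implicit.
Unset Printing Implicit Defensive.

Import GRing.Theory.

Local Open Scope classical_set_scope.

Section PathGroupoid.
Variable E : digraph.
Local Notation src := (@esrc E).
Local Notation rng := (@erng E).
Implicit Types (a b m : finpath E) (x y : bpath E) (z : infpath E)
  (p q s : seq (edge E)) (v : vertex E).

(** * Initial segments, tails and prefixes of boundary paths *)

Lemma walk_map_iota z n k : walk (src (z n)) (map z (iota n k)).
Proof. by elim: k n => //= k IHk n; rewrite eqxx infpathP IHk. Qed.

Lemma last_map_iota z n k :
  last (src (z n)) (map rng (map z (iota n k))) = src (z (n + k)%N).
Proof.
elim: k n => [|k IHk] n /=; first by rewrite addn0.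
by rewrite infpathP IHk addSnnS.
Qed.

Definition itake z n : finpath E :=
  @Finpath E (src (z 0%N), mkseq z n) (walk_map_iota z 0 n).

Lemma prng_itake z n : prng (itake z n) = src (z n).
Proof. exact: last_map_iota. Qed.

Lemma plen_itake z n : plen (itake z n) = n.
Proof. by rewrite /plen /= size_mkseq. Qed.

Definition itail z n : infpath E :=
  @Infpath E (fun k => z (k + n)%N) (fun k => infpathP z (k + n)).

Lemma bcat_itake z n (zn : prng (itake z n) = bsrc (BInf (itail z n))) :
  bcat zn = BInf z.
Proof.
apply: bpath_eq => [|k]; rewrite ?bsrc_bcat// bedge_bcat plen_itake.
case: ltnP => kn; last by rewrite /= subnK.
by rewrite (onth_nth_lt (z 0%N)) ?size_mkseq// nth_mkseq.
Qed.

(** Finite and infinite [y] are treated alike: if [y] is shorter than [a], some [bedge y n] is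
    [None] and the condition fails. The source is compared separately for [a] of length 0. *)
Definition bprefix a y : Prop :=
  psrc a = bsrc y /\
  forall n, (n < plen a)%N -> bedge y n = onth (pedges a) n.

Lemma bprefix_bcat a y (ay : prng a = bsrc y) : bprefix a (bcat ay).
Proof. by split=> [|n na]; rewrite ?bsrc_bcat// bedge_bcat na. Qed.

Lemma bprefix_pcat a m y (am : prng a = psrc m) (ay : prng a = bsrc y) :
  bprefix m y -> bprefix (pcat am) (bcat ay).
Proof.
move=> [_ my]; split=> [|n]; rewrite ?bsrc_bcat// plen_pcat bedge_bcat.
move=> nam; rewrite /= Defs.onth_cat -/(plen a); case: ltnP => // na.
by rewrite my// ltn_subLR//.
Qed.

Lemma bprefixP a y :
  bprefix a y -> exists c (ac : prng a = bsrc c), y = bcat ac.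
Proof.
case: y => [[[v p] vp] Y|z] [/= ay aE].
- pose q := drop (plen a) p.
  have pE : p = pedges a ++ q.
    rewrite -[LHS](cat_take_drop (plen a)); congr (_ ++ _).
    apply: Defs.onth_inj => n.
    have ap : (plen a <= size p)%N.
      rewrite leqNgt; apply/negP => pa; have := aE _ pa.
      rewrite Defs.onth_oversize//; move: pa; rewrite /plen.
      by case: (pedges a) => // e0 s pa; rewrite (onth_nth_lt e0).
    case: (ltnP n (plen a)) => na; last first.
      by rewrite !Defs.onth_oversize// size_takel.
    rewrite -aE// /pedges/= -{2}[p](cat_take_drop (plen a)) Defs.onth_cat.
    by rewrite size_takel// na.
  have wq : walk (prng a) q.
    by have := vp; rewrite /= pE -[v]ay walk_cat => /andP[].
  pose c := @Finpath E (prng a, q) wq.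
  have cY : infinite_emitter (prng c).
    move: Y; rewrite /prng /psrc /pedges /= pE map_cat last_cat.
    by rewrite -[v]ay.
  exists (BFin cY), erefl; apply: bpath_eq => [|n]; first by rewrite bsrc_bcat.
  by rewrite bedge_bcat/= {1}/pedges/= pE Defs.onth_cat.
- have [k ->] : exists k, a = itake z k.
    exists (plen a); apply: finpath_eq => //; apply: Defs.onth_inj => n.
    case: (ltnP n (plen a)) => na; last first.
      by rewrite !Defs.onth_oversize// size_mkseq.
    by rewrite -aE//= (onth_nth_lt (z 0%N)) ?size_mkseq// nth_mkseq.
  have zk : prng (itake z k) = bsrc (BInf (itail z k)) by rewrite prng_itake.
  by exists (BInf (itail z k)), zk; rewrite bcat_itake.
Qed.

(** Degree 0 makes [a] and [b] prefixes of [y] of equal length, hence equal. So a basic open set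
    that contains a unit comes from a pair [(a, a)]. *)
Lemma is_lag_diag a b y : is_lag a b y 0%R y -> a = b /\ bprefix a y.
Proof.
move=> [c [ac [bc [yE d0 yE']]]].
have [sa aE] : bprefix a y by rewrite yE; exact: bprefix_bcat.
have [sb bE] : bprefix b y by rewrite yE'; exact: bprefix_bcat.
have ab : plen a = plen b by lia.
split=> //; apply: finpath_eq; first by rewrite sa sb.
apply: Defs.onth_inj => n; case: (ltnP n (plen a)) => na; last first.
  by rewrite !Defs.onth_oversize// -/(plen b) -ab.
by rewrite -aE// -bE// -ab.
Qed.

Lemma is_lag_bprefix a y : bprefix a y -> is_lag a a y 0%R y.
Proof. by move=> /bprefixP[c [ac ->]]; exists c, ac, ac; rewrite subrr. Qed.

(** * Neighbourhoods in the unit space *)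

Definition bcylinder a (ms : seq (finpath E)) : set (bpath E) :=
  [set y | bprefix a y /\ forall m (am : prng a = psrc m), m \in ms ->
    ~ bprefix (pcat am) y].

Lemma basic_open_punit a ms y :
  basic_open a a ms (punit y) <-> bcylinder a ms y.
Proof.
split=> [[/is_lag_diag[_ ay] nms]|[ay nms]]; split=> //.
- move=> m am mms /is_lag_bprefix amy; apply: nms; exists m => //.
  by exists am, am.
- exact: is_lag_bprefix.
- by move=> [m mms [am [bm /is_lag_diag[_]]]]; exact: nms.
Qed.

Local Notation X := (unit_space (path_groupoid E)).

Lemma nbhs_bcylinder a ms y (B : set X) :
  (forall m, m \in ms -> psrc m = prng a) -> bcylinder a ms y ->
  bcylinder a ms `<=` B -> nbhs (y : X) B.
Proof.
move=> msa ay sub; exists ((@punit E : X -> parrow E) @^-1` basic_open a a ms).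
split.
- exists (basic_open a a ms) => //; exists [set basic_open a a ms].
    by move=> _ ->; exists a, a, ms.
  by rewrite bigcup_set1.
- exact/basic_open_punit.
- by move=> x /basic_open_punit/sub.
Qed.

Lemma nbhs_bcylinderP y (B : set X) : nbhs (y : X) B ->
  exists a ms, bcylinder a ms y /\ bcylinder a ms `<=` B.
Proof.
move=> [_ [[O [D' sD <-] <-] [W D'W Wy] sub]].
have [a [b [ms [ab msa WE]]]] := sD _ D'W.
rewrite WE in D'W Wy; have [/is_lag_diag[abE _] _] := Wy; subst b.
exists a, ms; split; first exact/basic_open_punit.
by move=> x /basic_open_punit ax; apply: sub; exists (basic_open a a ms).
Qed.

(** The excluded extensions are finitely many, and each already disagrees with [z] within its own
    length; agreement with [z] up to the longest of them therefore suffices. *)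
Lemma nbhs_infpathP z (B : set X) : nbhs (BInf z : X) B -> exists N, forall x,
  bsrc x = src (z 0%N) -> (forall n, (n < N)%N -> bedge x n = Some (z n)) -> B x.
Proof.
move=> /nbhs_bcylinderP[a [ms [[[az aE] nms] sub]]].
exists (plen a + \max_(m <- ms) plen m)%N => x xz xE; apply: sub; split.
  split; first by rewrite az xz.
  by move=> n na; rewrite xE ?ltn_addr// -aE.
move=> m am mms [amx mE]; apply: (nms m am mms); split=> // n namn.
rewrite -mE// xE//; apply: leq_trans namn _; rewrite plen_pcat leq_add2l.
exact: leq_bigmax_seq.
Qed.

(** * Isotropy of finite and infinite paths *)

Lemma lag_shift a b x (d : int) y n : is_lag a b x d y ->
  bedge x (plen a + n) = bedge y (plen b + n).
Proof.
move=> [c [ac [bc [-> _ ->]]]]; rewrite !bedge_bcat.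
by rewrite ![(_ + n < _)%N]ltnNge !leq_addr /= !addKn.
Qed.

Lemma parrow_isotropy (g : parrow E) (u : bpath E) :
  isotropy (path_groupoid E) u g -> adeg g = 0%R -> g = punit u.
Proof. by move=> [gu gu'] g0; apply: parrow_eq. Qed.

(** Removing the same tail from two copies of one finite path leaves heads of equal length, so the
    degree is 0. *)
Lemma trivial_isotropy_fin a (Y : infinite_emitter (prng a)) :
  trivial_isotropy (path_groupoid E) (BFin Y).
Proof.
apply/seteqP; split=> [g gY|_ ->]; last by split.
apply: (parrow_isotropy gY); have [b [d [c [bc [dc]]]]] := parrowP g.
have [/= -> ->] := gY; case: c bc dc => [c C|z] /= bc dc [] // [ab] dE [ad].
have := plen_pcat bc; have := plen_pcat dc; rewrite -ab -ad => dcE bcE.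
by rewrite dE; lia.
Qed.

(** An isotropy arrow of nonzero degree identifies two shifts of [z]; the absolute value of the
    degree is an eventual period. *)
Lemma nontrivial_isotropy_inf z : ~ trivial_isotropy (path_groupoid E) (BInf z) ->
  exists N k, (0 < k)%N /\ forall n, (N <= n)%N -> z (n + k)%N = z n.
Proof.
move=> nt.
have [g gz g0] : exists2 g, isotropy (path_groupoid E) (BInf z) g & adeg g <> 0%R.
  apply: contrapT => /forall2NP ng; apply: nt; apply/seteqP; split=> [g gz|_ ->];
    last by split.
  by apply: (parrow_isotropy gz); apply: contrapT; case: (ng g).
have [a [b ab]] := parrowP g.
have dE : adeg g = (Posz (plen a) - Posz (plen b))%R by case: ab => c [? [? []]].
have zE n : z (plen a + n)%N = z (plen b + n)%N.
  by have := lag_shift n ab; case: gz => /= -> -> [].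
case: (ltngtP (plen a) (plen b)) => [lt|lt|eq].
- exists (plen a), (plen b - plen a)%N; split=> [|n an]; first by lia.
  have -> : (n + (plen b - plen a) = plen b + (n - plen a))%N by lia.
  by rewrite -zE subnKC.
- exists (plen b), (plen a - plen b)%N; split=> [|n an]; first by lia.
  have -> : (n + (plen a - plen b) = plen a + (n - plen b))%N by lia.
  by rewrite zE subnKC.
- by exfalso; apply: g0; rewrite dE; lia.
Qed.

(** * Loops and closed walks *)

(** The cut is made just after the first edge with range [v]; what remains is again a closed walk,
    possibly empty. *)
Lemma first_return v p : walk v p -> last v (map rng p) = v -> p <> [::] ->
  exists l q, [/\ loop_at v l, p = pedges l ++ q, walk v q &
    last v (map rng q) = v].
Proof.
move=> vp pv p0; pose i := find (fun e => rng e == v) p.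
have ip : (i < size p)%N.
  rewrite -has_find; case/lastP: p p0 pv {vp i} => // p e _.
  by rewrite map_rcons last_rcons -cats1 has_cat /= => ->; rewrite eqxx orbT.
have e0 : edge E by case: (p) p0.
have iv : rng (nth e0 p i) = v.
  apply/eqP; apply: (nth_find e0 (a := fun e => rng e == v)).
  by rewrite has_find.
have st : size (take i.+1 p) = i.+1 by rewrite size_takel.
have takev : last v (map rng (take i.+1 p)) = v.
  by rewrite (last_nth v) size_map st /= (nth_map e0) ?st// nth_take.
have := vp; rewrite -{1}(cat_take_drop i.+1 p) walk_cat takev => /andP[wt wd].
have dropv : last v (map rng (drop i.+1 p)) = v.
  by rewrite -{2}pv -{2}(cat_take_drop i.+1 p) map_cat last_cat takev.
exists (@Finpath E (v, take i.+1 p) wt), (drop i.+1 p).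
split=> //; last by rewrite cat_take_drop.
split=> //; rewrite /plen /pedges /= st //= => e.
rewrite take_takel// => /(nthP e0)[j]; rewrite size_takel ?(ltnW ip)// => ji <-.
by rewrite nth_take//; apply/eqP; have := before_find e0 ji => /= ->.
Qed.

(** If [k] went on after [l], the last edge of [l] would bring [k] back to [v] too early. *)
Lemma loop_at_prefix v (l k : finpath E) : loop_at v l -> loop_at v k ->
  prefix (pedges l) (pedges k) -> l = k.
Proof.
move=> [l0 lv lv' _] [_ kv _ kN] /prefixP[q kE].
apply: finpath_eq; first by rewrite lv kv.
case: q kE => [|e q] kE; first by rewrite kE cats0.
exfalso; move: l0 lv' kN; rewrite /plen /prng lv kE.
case/lastP: (pedges l) => // s f _; rewrite map_rcons last_rcons => fv /(_ f).
apply=> //; rewrite size_cat size_rcons /= addnS /= take_cat.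
by rewrite size_rcons ltnNge leq_addr /= mem_cat mem_rcons inE eqxx.
Qed.

(** * Aperiodic paths by a diagonal construction *)

(* Neither [p] nor [q] is to be a prefix of the other, so [f i] cannot agree with
   both extensions: step [i.+1] takes one that disagrees with [f i]. *)
Fixpoint avoid (u p q : seq (edge E)) (f : nat -> nat -> edge E) (j : nat) :=
  if j is i.+1 then
    let d := avoid u p q f i in
    if d ++ p == mkseq (f i) (size (d ++ p)) then d ++ q else d ++ p
  else u.

(** The words [avoid] are walks from [v] to [t], each a prefix of the next; [w] is their union and
    meets [t] at the end of each of them. *)
Lemma avoiding_infpath v t u p q (f : nat -> nat -> edge E) :
  walk v u -> last v (map rng u) = t ->
  walk t p -> last t (map rng p) = t -> walk t q -> last t (map rng q) = t ->
  ~~ prefix p q -> ~~ prefix q p ->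
  exists w : infpath E, [/\ src (w 0%N) = v, mkseq w (size u) = u,
    forall M, exists2 k, (M <= k)%N & src (w k) = t &
    forall j, exists n, w n <> f j n].
Proof.
move=> vu ut tp pt tq qt pq qp.
have p0 : (0 < size p)%N by case: (p) pq => //; rewrite prefix0s.
have q0 : (0 < size q)%N by case: (q) qp => //; rewrite prefix0s.
have e0 : edge E by case: (p) p0.
set d := avoid u p q f.
have dS j : d j.+1 = d j ++ q \/ d j.+1 = d j ++ p.
  by rewrite /d /=; case: ifP; [left|right].
have dw j : walk v (d j) /\ last v (map rng (d j)) = t.
  elim: j => // j [jw jt].
  by case: (dS j) => ->; rewrite walk_cat map_cat last_cat jt jw.
have dsz j : (j <= size (d j))%N.
  by elim: j => // j jd; case: (dS j) => ->; rewrite size_cat; lia.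
have dpre j k : exists r, d (j + k)%N = d j ++ r.
  elim: k => [|k [r rE]]; first by exists [::]; rewrite addn0 cats0.
  by rewrite addnS; case: (dS (j + k)%N) => ->; rewrite rE -catA; eexists.
have dnth j k n : (n < size (d j))%N -> (n < size (d k))%N ->
    nth e0 (d j) n = nth e0 (d k) n.
  wlog jk : j k / (j <= k)%N.
    by move=> H nj nk; case: (leqP j k) => [/H|/ltnW /H]; [exact|move->].
  by move=> nj _; have [r] := dpre j (k - j)%N; rewrite subnKC// => ->;
    rewrite nth_cat nj.
(* By [dsz], [d n.+1] has more than [n] edges, so the default [e0] is never read. *)
pose w0 n := nth e0 (d n.+1) n.
have w0E j n : (n < size (d j))%N -> w0 n = nth e0 (d j) n.
  by move=> nj; apply: dnth => //; exact: dsz.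
have w0P n : rng (w0 n) = src (w0 n.+1).
  have n2 := dsz n.+2; rewrite (w0E n.+2) ?(ltnW n2)// (w0E n.+2 n.+1)//.
  exact: (walk_nth _ (proj1 (dw n.+2))).
pose w := @Infpath E w0 w0P.
have wd j : mkseq w (size (d j)) = d j.
  apply: (@eq_from_nth _ e0); rewrite size_mkseq// => n nj.
  by rewrite nth_mkseq//; exact: w0E.
have w0v : src (w 0%N) = v.
  rewrite /= (w0E 1%N) ?dsz//; have := proj1 (dw 1%N); have := dsz 1%N.
  by case: (d 1%N) => //= e s _ /andP[/eqP].
exists w; split=> //; first exact: (wd 0%N).
- move=> M; exists (size (d M)); first exact: dsz.
  by rewrite -prng_itake /prng /pedges /= wd [psrc _]w0v; case: (dw M).
- move=> j; apply: contrapT => /forallNP wf.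
  have := wd j.+1; have -> : mkseq w =1 mkseq (f j).
    by move=> k; apply: eq_map => n; apply: contrapT; exact: wf.
  rewrite /d /= -/d; case: ifP => [/eqP jp|/negP jp] jq; last first.
    by apply: jp; rewrite jq.
  (* If [w] were [f j], both [d j ++ p] and [d j ++ q] would be initial segments of [f j], and the
     shorter of [p] and [q] would be a prefix of the other. *)
  have pref r r' : d j ++ r = mkseq (f j) (size (d j ++ r)) ->
      d j ++ r' = mkseq (f j) (size (d j ++ r')) ->
      (size r <= size r')%N -> prefix r r'.
    move=> rE r'E rr'; rewrite prefixE; apply/eqP.
    have : take (size (d j ++ r)) (d j ++ r') = d j ++ r.
      rewrite r'E [RHS]rE /mkseq -map_take take_iota; congr (map _ (iota _ _)).
      by apply/minn_idPl; rewrite !size_cat leq_add2l.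
    rewrite take_cat size_cat ltnNge leq_addr addKn /= => /eqP.
    by rewrite eqseq_cat// eqxx => /eqP.
  case: (leqP (size p) (size q)) => [le|/ltnW le].
  + by move/negP: pq; apply; exact: pref.
  + by move/negP: qp; apply; exact: pref.
Qed.

(** Enumerates the eventually periodic words: in the code [(s, N, k)], [s] is meant to carry the
    first [N] edges and one period of length [k]. *)
Definition periodic_word (e0 : edge E) (j : nat) (n : nat) : edge E :=
  if unpickle j is Some (s, N, k) then
    nth e0 s (if (n < N)%N then n else N + (n - N) %% k)
  else e0.

Lemma periodic_wordP e0 z N k : (0 < k)%N ->
  (forall n, (N <= n)%N -> z (n + k)%N = z n) ->
  exists j, forall n, z n = periodic_word e0 j n.
Proof.
move=> k0 zk; exists (pickle (mkseq z (N + k), N, k)) => n.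
rewrite /periodic_word pickleK; case: ltnP => nN.
  by rewrite nth_mkseq ?ltn_addr.
rewrite nth_mkseq ?ltn_add2l ?ltn_pmod//.
have zm i r : z (N + r + i * k)%N = z (N + r)%N.
  elim: i => [|i IHi]; first by rewrite addn0.
  by rewrite mulSn addnCA addnC zk ?IHi// -addnA leq_addr.
by rewrite -(zm ((n - N) %/ k)%N) -addnA [(_ %% _ + _)%N]addnC -divn_eq subnKC.
Qed.

(** * Condition (K) implies essential principality *)

Lemma essentially_principal_of_condition_K :
  condition_K E -> essentially_principal (path_groupoid E).
Proof.
move=> K F Fcl Finv x Fx B Bx.
have [tx|ntx] := pselect (trivial_isotropy (path_groupoid E) x).
  by exists x; split=> //; exact: nbhs_singleton.
case: x Fx Bx ntx => [y Y|z] Fz Bz nt.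
  by case: nt; exact: trivial_isotropy_fin.
have [N0 [k0 [k0_gt0 zk0]]] := nontrivial_isotropy_inf nt.
have [N BN] := nbhs_infpathP Bz.
(* Past [N], so that a path sharing the first [n0] edges of [z] is near [z]; past [N0], so that [v]
   lies on the period. *)
pose n0 := (N + N0)%N; set v := src (z n0).
have [|//||l [_ [lv _ _ _]]] := @first_return v (map z (iota n0 k0)).
- exact: walk_map_iota.
- by rewrite last_map_iota zk0// leq_addl.
- by case: (k0) k0_gt0.
have [l' [l'v ll']] : exists l', loop_at v l' /\ l <> l'.
  apply: contrapT => /forallNP nl; apply: (K v); exists l; split=> // l' l'v.
  by apply: contrapT => ll'; apply: (nl l').
have [_ lv1 lv2 _] := lv; have [_ l'v1 l'v2 _] := l'v.
have [||||||//|//|w [w0 wu wv wper]] := @avoiding_infpath (src (z 0%N)) v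
  (mkseq z n0) (pedges l) (pedges l') (periodic_word (z 0%N)).
- exact: (walk_map_iota z 0).
- exact: (last_map_iota z 0).
- by rewrite -lv1; exact: (finpathP l).
- by rewrite -{1}lv1.
- by rewrite -l'v1; exact: (finpathP l').
- by rewrite -{1}l'v1.
- by apply/negP => /(loop_at_prefix lv l'v).
- by apply/negP => /(loop_at_prefix l'v lv) /esym.
have wz n : (n < n0)%N -> w n = z n.
  move=> nn0; have := congr1 (fun s => nth (z 0%N) s n) wu.
  by rewrite size_mkseq !nth_mkseq.
exists (BInf w); split; last first.
  by apply: BN => //= n nN; rewrite wz// ltn_addr.
split; last first.
  apply: contrapT => /nontrivial_isotropy_inf[M [k [k_gt0 wk]]].
  have [j jw] := periodic_wordP (z 0%N) k_gt0 wk.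
  by have [n] := wper j; apply.
(* [w] is a limit of points of [F]: its first [k] edges end at [v], so the tail of [z] from [n0] can
   follow them, and an arrow joins the result to [z]. *)
apply: Fcl => C /nbhs_infpathP[M CM]; have [k Mk kv] := wv M.
have wkz : prng (itake w k) = bsrc (BInf (itail z n0)) by rewrite prng_itake.
have zz : prng (itake z n0) = bsrc (BInf (itail z n0)) by rewrite prng_itake.
have yP : exists a b, is_lag a b (bcat wkz)
    (Posz (plen (itake w k)) - Posz (plen (itake z n0)))%R (BInf z).
  by exists (itake w k), (itake z n0), (BInf (itail z n0)), wkz, zz;
    rewrite bcat_itake.
exists (bcat wkz); split; first exact: (proj2 (Finv (Parrow yP))).
apply: CM => [|n nM]; first by rewrite bsrc_bcat.
rewrite bedge_bcat plen_itake (leq_trans nM Mk).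
by rewrite (onth_nth_lt (w 0%N)) ?size_mkseq ?nth_mkseq ?(leq_trans nM Mk).
Qed.

(** * The closed invariant set attached to a vertex *)

Definition reach (u v : vertex E) : Prop :=
  exists2 p, walk u p & last u (map rng p) = v.

Lemma reach_trans v u t : reach u v -> reach v t -> reach u t.
Proof.
move=> [p up pv] [q vq qt]; exists (p ++ q); first by rewrite walk_cat up pv.
by rewrite map_cat last_cat pv.
Qed.

Lemma reach_edge (e : edge E) : reach (src e) (rng e).
Proof. by exists [:: e] => //=; rewrite eqxx. Qed.

Lemma reach_finpath a : reach (psrc a) (prng a).
Proof. by exists (pedges a) => //; exact: (finpathP a). Qed.

Lemma reach_infpath z n k : reach (src (z n)) (src (z (n + k)%N)).
Proof.
exists (map z (iota n k)); first exact: walk_map_iota.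
exact: last_map_iota.
Qed.

(* For a finite path, one returning edge is not enough: the finite paths along a
   unique loop through infinite emitters would then belong to the set, have
   trivial isotropy and accumulate at the infinite power of the loop. *)
Definition recurrent v : set (bpath E) :=
  [set y | match y with
    | BFin a _ => infinite_set [set e | src e = prng a /\ reach (rng e) v]
    | BInf z => forall n, reach (src (z n)) v
    end].

(** Membership depends only on the tail: a finite path keeps its range, and each vertex of an
    infinite path reaches the later ones. *)
Lemma recurrent_bcat v a y (ay : prng a = bsrc y) :
  recurrent v (bcat ay) <-> recurrent v y.
Proof.
case: y ay => [b Y|z] ay; first by rewrite /recurrent /= (prng_pcat ay).
split=> [zr n|zr n].
  have /= := zr (plen a + n)%N; rewrite /icat_edge nth_default ?leq_addr//.
  by rewrite addKn.
apply: reach_trans (reach_infpath _ n (plen a)) _.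
by rewrite /= /icat_edge nth_default ?leq_addl// addnK.
Qed.

Lemma recurrent_reach v y : recurrent v y -> reach (bsrc y) v.
Proof.
case: y => [a Y /= /infinite_setN0[e [ea ev]]|z /(_ 0%N)//].
apply: reach_trans (reach_finpath a) _; rewrite -ea.
exact: reach_trans (reach_edge e) ev.
Qed.

Lemma invariant_recurrent v : invariant_set (path_groupoid E) (recurrent v).
Proof.
move=> g; have [a [b [c [ac [bc [gr _ gs]]]]]] := parrowP g.
by rewrite /= gr gs !recurrent_bcat.
Qed.

Definition edge_path (e : edge E) : finpath E :=
  @Finpath E (src e, [:: e]) (introT andP (conj (eqxx _) isT)).

Lemma bprefix_edge_path y (e : edge E) :
  bedge y 0 = Some e -> bprefix (edge_path e) y.
Proof.
move=> ye; split; last by case.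
case: y ye => [[[v p] vp] _|z] /= => [|[->]//]; move: vp.
by rewrite /pedges /psrc; case: p => //= f p /andP[/eqP fv _] [<-].
Qed.

(** A finite path outside the set has finitely many last-vertex edges leading to [v]; the
    neighbourhood excluding them misses the set. An infinite path outside has a vertex that cannot
    reach [v]; the initial segment up to it gives the neighbourhood. *)
Lemma closed_recurrent v : closed (recurrent v : set X).
Proof.
move=> y ycl; apply: contrapT; case: y ycl => [a Y|z] ycl /=.
  move=> /contrapT/finite_seqP[s sE].
  have sP e : (e \in s) = `[< src e = prng a /\ reach (rng e) v >].
    apply/idP/asboolP => [es|ea].
      by have : [set` s] e by []; rewrite -sE.
    by have : [set` s] e by rewrite -sE.
  have /ycl[x [xr [/bprefixP[c [ac xE]] nx]]] :
      nbhs (BFin Y : X) (bcylinder a (map edge_path s)).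
    apply: (@nbhs_bcylinder a (map edge_path s)) => //.
      by move=> m /mapP[e]; rewrite sP => /asboolP[ea _] ->.
    split=> // m am /mapP[e _ mE] [_ /(_ (plen a))]; subst m.
    rewrite plen_pcat /plen /= addn1 leqnn Defs.onth_oversize//.
    by rewrite Defs.onth_cat ltnn subnn => /(_ isT).
  subst x; move/recurrent_bcat: xr => cr.
  case eE: (bedge c 0) => [e|].
    have ec := bprefix_edge_path eE; have [ea _] := ec.
    have am : prng a = psrc (edge_path e) by rewrite ac -ea.
    apply: (nx _ am); last exact: bprefix_pcat.
    rewrite map_f// sP; apply/asboolP; split; first by rewrite -[src e]am.
    have [c' [ec' cE]] := bprefixP ec; rewrite -[rng e]/(prng (edge_path e)) ec'.
    by apply: recurrent_reach; move: cr; rewrite cE => /recurrent_bcat.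
  case: c ac cr nx eE => // b C /= ac cr nx bN; apply: cr.
  have -> : prng b = prng a.
    by rewrite ac /prng; case: (pedges b) bN.
  by apply/finite_seqP; exists s.
move=> /existsNP[n nr].
have /ycl[x [xr [/bprefixP[c [ac xE]] _]]] :
    nbhs (BInf z : X) (bcylinder (itake z n) [::]).
  apply: (@nbhs_bcylinder (itake z n) [::]) => //; split=> //.
  split=> // k; rewrite plen_itake => kn.
  by rewrite (onth_nth_lt (z 0%N)) ?size_mkseq// nth_mkseq.
subst x; apply: nr; rewrite -prng_itake ac.
by move/recurrent_bcat: xr; exact: recurrent_reach.
Qed.

(** * A vertex with a unique loop *)

Section UniqueLoop.
Variables (v : vertex E) (l : finpath E).
Hypotheses (lv : loop_at v l) (l_uniq : forall k, loop_at v k -> l = k).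

Let l_gt0 : (0 < plen l)%N. Proof. by case: lv. Qed.

(** Serves only as a default value for [nth]. *)
Lemma loop_edge : edge E.
Proof. by move: l_gt0; rewrite /plen; case: (pedges l). Qed.

Definition loop_power_edge n := nth loop_edge (pedges l) (n %% plen l).

Lemma src_loop_edge0 : src (loop_power_edge 0) = v.
Proof.
have [_ <- _ _] := lv; rewrite /loop_power_edge mod0n; move: l_gt0 (finpathP l).
rewrite /plen /pedges /psrc; case: (finpath_val l) => u [|e s] //= _.
by case/andP => /eqP.
Qed.

Lemma loop_power_edgeP n :
  rng (loop_power_edge n) = src (loop_power_edge n.+1).
Proof.
have := ltn_pmod n l_gt0; rewrite /loop_power_edge modnS => nl.
(* Either [n] is the last edge of a turn and the next edge starts at [v] again, or both edges lie in
   the same turn. *)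
have : (n %% plen l).+1 = plen l \/ ((n %% plen l).+1 < plen l)%N by lia.
case=> nE.
  have dvd : (plen l %| n.+1)%N.
    by rewrite (divn_eq n (plen l)) -addnS nE dvdn_addl// dvdn_mull.
  rewrite dvd; have := src_loop_edge0; rewrite /loop_power_edge mod0n => ->.
  have [_ _ <- _] := lv; rewrite /prng (last_nth (psrc l)) size_map -/(plen l).
  by rewrite -[X in _ = nth _ _ X]nE /= (nth_map loop_edge).
have -> : (plen l %| n.+1) = false.
  by rewrite (divn_eq n (plen l)) -addnS dvdn_addr ?dvdn_mull// gtnNdvd.
exact: walk_nth (finpathP l) nE.
Qed.

Definition loop_power : infpath E := Infpath loop_power_edgeP.

Lemma loop_power_addl n : loop_power (plen l + n)%N = loop_power n.
Proof. by rewrite /= /loop_power_edge modnDl. Qed.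

(** Induction on the length: the first return splits off a loop, which must be [l]. *)
Lemma closed_walk_loop_power p : walk v p -> last v (map rng p) = v ->
  forall n, (n < size p)%N -> nth loop_edge p n = loop_power n.
Proof.
have [k] := ubnP (size p); elim: k p => // k IHk p pk vp pv n np.
have [|l' [q [/l_uniq <- pE vq qv]]] := first_return vp pv.
  by move: np; case: (p).
rewrite pE nth_cat -/(plen l); case: ltnP => nl.
  by rewrite /= /loop_power_edge modn_small.
rewrite IHk//; first by rewrite -{2}(subnKC nl) loop_power_addl.
  by move: pk l_gt0; rewrite pE size_cat -/(plen l); lia.
by move: np; rewrite pE size_cat -/(plen l); lia.
Qed.

Lemma recurrent_loop_power : recurrent v (BInf loop_power).
Proof.
move=> n; have := reach_infpath loop_power n (n * plen l - n).
rewrite subnKC ?leq_pmulr//= {2}/loop_power_edge modnMl.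
by have := src_loop_edge0; rewrite /loop_power_edge mod0n => ->.
Qed.

(** Initial segments of a member can be closed up to walks at [v], so they follow [l]. This
    determines an infinite member; at the end of a finite one, infinitely many edges would all equal
    the same edge of [loop_power]. *)
Lemma recurrent_at_loop y : recurrent v y -> bsrc y = v -> y = BInf loop_power.
Proof.
case: y => [a Y|z] /= yr yv.
  case: yr; apply: (@sub_finite_set _ _ [set loop_power (plen a)]) => //.
  move=> e [ea [p ep pv]] /=.
  have := @closed_walk_loop_power (pedges a ++ e :: p) _ _ (plen a).
  rewrite nth_cat ltnn subnn /=; apply.
  - rewrite walk_cat -yv [last (psrc a) _](esym ea) /= eqxx ep.
    by rewrite !andbT; exact: (finpathP a).
  - by rewrite map_cat last_cat.
  - by rewrite size_cat /= -/(plen a); lia.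
congr BInf; apply: infpath_eq => n; have [p np pv] := yr n.+1.
have := @closed_walk_loop_power (mkseq z n.+1 ++ p) _ _ n.
rewrite nth_cat size_mkseq ltnSn nth_mkseq//; apply.
- rewrite walk_cat -yv (walk_map_iota z 0) (last_map_iota z 0).
  exact: np.
- by rewrite map_cat last_cat -{1}yv (last_map_iota z 0).
- by rewrite size_cat size_mkseq; lia.
Qed.

(** Putting [l] in front of its infinite power changes nothing, which gives an isotropy arrow of
    degree [plen l]. *)
Lemma nontrivial_isotropy_loop_power :
  ~ trivial_isotropy (path_groupoid E) (BInf loop_power).
Proof.
pose o := @Finpath E (v, [::]) isT.
have [_ _ rv _] := lv; have xv := src_loop_edge0.
have lx : prng l = bsrc (BInf loop_power) by rewrite rv.
have ox : prng o = bsrc (BInf loop_power) by [].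
have gP : exists a b, is_lag a b (BInf loop_power) (Posz (plen l) - 0)%R
    (BInf loop_power).
  exists l, o, (BInf loop_power), lx, ox; split=> //; apply: bpath_eq => [|n].
  - by rewrite bsrc_bcat; have [_ ->] := lv.
  - rewrite bedge_bcat; case: ltnP => nl; last first.
      by congr Some; rewrite -{1}(subnKC nl); exact: loop_power_addl.
    by rewrite (onth_nth_lt loop_edge)//= /loop_power_edge modn_small.
  - by rewrite bsrc_bcat.
  - by rewrite bedge_bcat /= subn0.
move=> /seteqP[/(_ (Parrow gP)) triv _].
have /triv/(congr1 (@adeg E)) /= :
    isotropy (path_groupoid E) (BInf loop_power) (Parrow gP) by split.
by rewrite subr0; case: (plen l) l_gt0.
Qed.

End UniqueLoop.

Lemma condition_K_of_essentially_principal :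
  essentially_principal (path_groupoid E) -> condition_K E.
Proof.
move=> ep v [l [lv l_uniq]].
have := ep _ (@closed_recurrent v) (@invariant_recurrent v) _
  (recurrent_loop_power lv).
pose o := @Finpath E (v, [::]) isT.
(* The paths starting at [v] form a neighbourhood that meets the closed set only in [loop_power]. *)
have oN : nbhs (BInf (loop_power lv) : X) (bcylinder o [::]).
  apply: (@nbhs_bcylinder o [::]) => //; split=> //; split=> //.
  by rewrite /= src_loop_edge0.
move=> /(_ _ oN)[y [[yr yt] [[vy _] _]]].
have yE := recurrent_at_loop lv l_uniq yr (esym vy).
by move: yt; rewrite yE; exact: nontrivial_isotropy_loop_power.
Qed.

End PathGroupoid.

Theorem proposition8 (E : digraph) (hE : no_sinks E) :
  essentially_principal (path_groupoid E) <-> condition_K E.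
Proof.
split; first exact: condition_K_of_essentially_principal.
exact: essentially_principal_of_condition_K.
Qed.
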